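(* Let $x\in D(A)$ and $t\geq 0$. (i) It holds $S(t)x\in D(A)$ with $AS(t)x=S'_+(t,x)Ax$. If $S(t)$ is linear, this results in the relation $AS(t)x=S(t)Ax$. (ii) For $t>0$, it holds $\lim_{h\downarrow 0}\frac{S(t)x-S(t-h)x}{h}=S'_-(t,x)Ax$. (iii) It holds $S'_+(t,x)Ax=S'_-(t,x)Ax$. The mapping $[0,\infty)\to X$, $s\mapsto S(s)x$ is continuously differentiable and the derivative is given by $\frac{\mathrm{d}}{\mathrm{d}s}S(s)x=AS(s)x=S'_\pm(s,x)Ax$ for $s\geq 0$. (iv) It holds $S(t)x-x=\int_0^t AS(s)x\,\mathrm{d}s=\int_0^t S'_+(s,x)Ax\,\mathrm{d}s=\int_0^t S'_-(s,x)Ax\,\mathrm{d}s$.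
   Context: Let $X$ be a Banach lattice with order continuous norm (i.e., for every net $(x_\alpha)$ with $x_\alpha\downarrow 0$ one has $\|x_\alpha\|\to 0$). An operator $T\colon X\to X$ is called bounded if $\sup_{\|x\|\le r}\|Tx\|<\infty$ for all $r>0$, and convex if $T(\lambda x+(1-\lambda)y)\le \lambda Tx+(1-\lambda)Ty$ for all $\lambda\in[0,1]$, $x,y\in X$. Let $S=(S(t))_{t\in[0,\infty)}$ be a convex $C_0$-semigroup on $X$, i.e., a family of bounded convex operators $X\to X$ with $S(0)x=x$, $S(t+s)x=S(t)S(s)x$ for all $s,t\ge 0$, $x\in X$, and $S(t)x\to x$ as $t\downarrow 0$ for all $x\in X$. Its generator $A\colon D(A)\subset X\to X$ is defined by $Ax:=\lim_{h\downarrow 0}\frac{S(h)x-x}{h}$, where $D(A)$ is the set of all $x\in X$ for which this limit exists in norm. For $t\ge 0$ and $x,y\in X$, the one-sided directional derivatives are defined by $S'_+(t,x)y:=\inf_{h>0}\frac{S(t)(x+hy)-S(t)x}{h}$ and $S'_-(t,x)y:=\sup_{h<0}\frac{S(t)(x+hy)-S(t)x}{h}$ (the infimum/supremum in the lattice $X$; these exist in $X$ and are norm limits of the corresponding difference quotients as $h\to 0$, by order continuity of the norm). *)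

(* Defs.v *)
From HB Require Import structures.
From mathcomp Require Import all_boot all_order all_algebra.
From mathcomp Require Import all_classical all_reals all_analysis.
Set Implicit Arguments. Unset Strict Implicit. Unset Printing Implicit Defensive.
Import Order.TTheory GRing.Theory Num.Theory.
Import numFieldNormedType.Exports.
Local Open Scope classical_set_scope.
Local Open Scope ring_scope.

Section BanachLattice.
Variables (R : realType) (X : completeNormedModType R) (le : X -> X -> Prop).

Definition is_lub (A : set X) (s : X) :=
  (forall a, A a -> le a s) /\ (forall u, (forall a, A a -> le a u) -> le s u).
Definition is_glb (A : set X) (i : X) :=
  (forall a, A a -> le i a) /\ (forall u, (forall a, A a -> le u a) -> le u i).

Record banach_lattice : Prop := {
  bl_refl : forall x, le x x;
  bl_antisym : forall x y, le x y -> le y x -> x = y;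
  bl_trans : forall x y z, le x y -> le y z -> le x z;
  bl_add : forall x y z, le x y -> le (x + z) (y + z);
  bl_scale : forall (a : R) x y, 0 <= a -> le x y -> le (a *: x) (a *: y);
  bl_sup : forall x y, exists s, is_lub [set x; y] s;
  bl_inf : forall x y, exists i, is_glb [set x; y] i;
  bl_norm : forall x y ax ay, is_lub [set x; - x] ax -> is_lub [set y; - y] ay ->
      le ax ay -> `|x| <= `|y|
}.

Definition order_continuous_norm : Prop :=
  forall (I : Type) (leI : I -> I -> Prop) (net : I -> X),
    (forall a, leI a a) ->
    (forall a b c, leI a b -> leI b c -> leI a c) ->
    (forall a b, exists c, leI a c /\ leI b c) ->
    (exists a : I, True) ->
    (forall a b, leI a b -> le (net b) (net a)) ->
    is_glb (range net) 0 ->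
    forall eps : R, 0 < eps -> exists a0, forall a, leI a0 a -> `|net a| < eps.

End BanachLattice.

Section Semigroup.
Variables (R : realType) (X : completeNormedModType R) (le : X -> X -> Prop).

(* S : [0,oo) -> (X -> X); values at negative times are irrelevant *)
Definition bounded_op (T : X -> X) : Prop :=
  forall r : R, 0 < r -> exists M : R, forall x, `|x| <= r -> `|T x| <= M.

Definition convex_op (T : X -> X) : Prop :=
  forall (l : R) x y, 0 <= l <= 1 ->
    le (T (l *: x + (1 - l) *: y)) (l *: T x + (1 - l) *: T y).

Definition linear_op (T : X -> X) : Prop :=
  forall (a b : R) x y, T (a *: x + b *: y) = a *: T x + b *: T y.

Definition convex_C0_semigroup (S : R -> X -> X) : Prop :=
  [/\ forall t, 0 <= t -> bounded_op (S t),
      forall t, 0 <= t -> convex_op (S t),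
      forall x, S 0 x = x,
      forall s t x, 0 <= s -> 0 <= t -> S (t + s) x = S t (S s x)
    & forall x, S t x @[t --> 0^'+] --> x].

Definition gen (S : R -> X -> X) (x y : X) : Prop :=
  h^-1 *: (S h x - x) @[h --> 0^'+] --> y.
Definition inD (S : R -> X -> X) (x : X) : Prop := exists y, gen S x y.
Definition genA (S : R -> X -> X) (x : X) : X := xget 0 (gen S x).

(* one-sided directional derivatives, as infimum / supremum in the lattice *)
Definition dplus (S : R -> X -> X) (t : R) (x y : X) : X :=
  xget 0 (is_glb le [set (h^-1 *: (S t (x + h *: y) - S t x)) | h in [set h : R | 0 < h]]).
Definition dminus (S : R -> X -> X) (t : R) (x y : X) : X :=
  xget 0 (is_lub le [set (h^-1 *: (S t (x + h *: y) - S t x)) | h in [set h : R | h < 0]]).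

End Semigroup.

Definition is_riemann_integral (R : realType) (X : normedModType R)
    (f : R -> X) (a b : R) (I : X) : Prop :=
  forall eps : R, 0 < eps -> exists2 delta : R, 0 < delta &
    forall (n : nat) (p q : nat -> R),
      p 0%N = a -> p n = b ->
      (forall i, (i < n)%N -> p i <= q i <= p i.+1 /\ p i.+1 - p i < delta) ->
      `| \sum_(i < n) (p i.+1 - p i) *: f (q i) - I | < eps.

(* Main.v *)
(* The difference quotients h |-> (T (x + h y) - T x) / h of a convex operator T are
   monotone, and order continuity of the norm makes them converge at 0+ to their
   infimum: together with the lower bounds of a decreasing family they give a net
   decreasing to 0, so the family is Cauchy.  A Baire argument makes the operators
   S t locally Lipschitz, uniformly for t in a compact interval.

   Let y = A x, f t = S'_+(t, x) y and g t = S'_-(t, x) y = - S'_+(t, x) (- y).  Writing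
   S h x = x + h y + o(h), the Lipschitz estimate shows that f is the right
   derivative of the orbit; the left derivative is g, because convexity also gives
   S h (x - h y) = x + o(h).  The chain rule f (t + h) = S'_+(h, S t x) (f t) and
   S'_+(h, z) w -> w show that f and g are right-continuous, and the mean value
   inequality for right derivatives then forces f = g.  Finally f = g lies between
   difference quotients with fixed steps +k and -k, which depend continuously on t, so f is
   continuous and the orbit is its primitive. *)
Require Import Defs.
From mathcomp Require Import all_boot all_order all_algebra.
From mathcomp Require Import all_classical all_reals all_analysis.
From mathcomp Require Import ring lra.
Set Implicit Arguments. Unset Strict Implicit. Unset Printing Implicit Defensive.
Import Order.TTheory GRing.Theory Num.Theory.
Import numFieldNormedType.Exports.
Local Open Scope classical_set_scope.
Local Open Scope ring_scope.

(** * Linear combinations *)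

(** Syntax for proof by reflection: an identity of linear combinations follows from one scalar
    identity per atom. *)
Inductive vexpr (R : Type) : Type :=
| VAtom of nat
| VZero
| VAdd of vexpr R & vexpr R
| VOpp of vexpr R
| VScale of R & vexpr R.
Arguments VAtom {R} _.
Arguments VZero {R}.

Section VectorIdentities.
Context {R : comPzRingType} {V : lmodType R}.

Fixpoint veval (env : seq V) (e : vexpr R) : V :=
  match e with
  | VAtom i => env`_i
  | VZero => 0
  | VAdd a b => veval env a + veval env b
  | VOpp a => - veval env a
  | VScale c a => c *: veval env a
  end.

Fixpoint vcoef (e : vexpr R) (i : nat) : R :=
  match e with
  | VAtom j => if eqn i j then 1 else 0
  | VZero => 0
  | VAdd a b => vcoef a i + vcoef b i
  | VOpp a => - vcoef a i
  | VScale c a => c * vcoef a i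
  end.

Lemma veval_sum (env : seq V) (e : vexpr R) :
  veval env e = \sum_(i < size env) vcoef e i *: env`_i.
Proof.
elim: e => [j||a IHa b IHb|a IHa|c a IHa] /=.
- have [jlt|jge] := ltnP j (size env).
    rewrite (bigD1 (Ordinal jlt)) //= (introT eqnP erefl) scale1r big1 ?addr0 //.
    move=> i /eqP neij; case: eqnP => [ij|_]; last by rewrite scale0r.
    by case: neij; apply/val_inj.
  rewrite nth_default // big1 // => i _; case: eqnP => [ij|_]; last by rewrite scale0r.
  by have := ltn_ord i; rewrite ij ltnNge jge.
- by rewrite big1 // => i _; rewrite scale0r.
- by rewrite IHa IHb -big_split /=; apply: eq_bigr => i _; rewrite scalerDl.
- by rewrite IHa -sumrN; apply: eq_bigr => i _; rewrite scaleNr.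
- by rewrite IHa scaler_sumr; apply: eq_bigr => i _; rewrite scalerA.
Qed.

(** The premise is a [foldr] so that [cbn] unfolds it into a conjunction of scalar equations. *)
Lemma veval_eq (env : seq V) (e1 e2 : vexpr R) :
  foldr (fun i P => vcoef e1 i = vcoef e2 i /\ P) True (iota 0 (size env)) ->
  veval env e1 = veval env e2.
Proof.
move=> H; rewrite !veval_sum; apply: eq_bigr => i _; congr (_ *: _).
have : (i : nat) \in iota 0 (size env) by rewrite mem_iota ltn_ord.
elim: iota H => //= j s IH [ej Hs]; rewrite inE => /orP[/eqP->//|]; exact: IH.
Qed.

End VectorIdentities.

Ltac vindex v env :=
  match env with
  | ?a :: _ => let _ := match goal with _ => unify v a end in constr:(0%N)
  | _ :: ?s => let i := vindex v s in constr:(S i)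
  end.
Ltac vreify R env t :=
  lazymatch t with
  | @GRing.add _ ?a ?b =>
      let ea := vreify R env a in let eb := vreify R env b in
      constr:(@VAdd R ea eb)
  | @GRing.opp _ ?a => let ea := vreify R env a in constr:(@VOpp R ea)
  | @GRing.scale _ _ ?c ?a => let ea := vreify R env a in constr:(@VScale R c ea)
  | @GRing.zero _ => constr:(@VZero R)
  | _ => let i := vindex t env in constr:(@VAtom R i)
  end.
(* Proves an equality of linear combinations of the listed vectors by comparing
   coefficients with [field]. *)
Ltac vec_eq R env :=
  lazymatch goal with
  | |- @eq ?X ?a ?b =>
    let e1 := vreify R env a in let e2 := vreify R env b in
    let H := fresh in
    have H := @veval_eq _ _ env e1 e2; cbn in H; refine (H _); clear H;
    repeat split; try ring; try field; try by rewrite ?gt_eqF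
  end.

(** * Banach lattices *)

Lemma cvg_unique_near {R : realType} {X : normedModType R} {T : Type} {F : set_system T}
    {FF : ProperFilter F} (f g : T -> X) (a b : X) :
  f @ F --> a -> g @ F --> b -> (\forall h \near F, f h = g h) -> a = b.
Proof.
move=> fa gb fg; have ga : g @ F --> a by apply: cvg_trans fa; exact: near_eq_cvg.
exact: (@norm_cvg_unique _ X (g @ F) _ a b ga gb).
Qed.

Section BanachLatticeTheory.
Context {R : realType} {X : completeNormedModType R} {le : X -> X -> Prop}.
Hypothesis HBL : banach_lattice le.

(** The order is translation invariant, so it depends on differences only. Most inequalities below
    are transported this way, leaving an identity for [vec_eq]. *)
Lemma le_shift (x y x' y' : X) : le x' y' -> y - x = y' - x' -> le x y.
Proof.
move=> /(bl_add HBL (x - x')) H E.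
have -> : x = x' + (x - x') by vec_eq R [:: x; x'].
have -> : y = y' + (x - x') by rewrite addrCA -E addrC subrK.
exact: H.
Qed.

Lemma leD (a b c d : X) : le a b -> le c d -> le (a + c) (b + d).
Proof.
move=> ab cd; apply: (bl_trans HBL (bl_add HBL c ab)).
by apply: (le_shift cd); vec_eq R [:: b; c; d].
Qed.

Lemma leN (a b : X) : le a b -> le (- b) (- a).
Proof. by move=> ab; apply: (le_shift ab); vec_eq R [:: a; b]. Qed.

Lemma abs_upper_bound_ge0 (a b : X) : le a b -> le (- a) b -> le 0 b.
Proof.
move=> ab nab; have H := bl_scale HBL (a := 2^-1) _ (leD ab nab).
have {}H := H ltac:(by rewrite invr_ge0).
by apply: (le_shift H); vec_eq R [:: a; b].
Qed.

Lemma is_lub_abs_ge0 (b : X) : le 0 b -> is_lub le [set b; - b] b.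
Proof.
move=> b0; split=> [a [->|->]|u]; first exact: bl_refl HBL b.
  by apply: (le_shift (leD b0 b0)); vec_eq R [:: b].
by apply; left.
Qed.

(** [bl_norm] compares moduli: [b] is positive, hence its own modulus, and it dominates the modulus
    of [a]. *)
Lemma le_norm (a b : X) : le a b -> le (- a) b -> `|a| <= `|b|.
Proof.
move=> ab nab; have [c cE] := bl_sup HBL a (- a).
apply: (bl_norm HBL cE (is_lub_abs_ge0 (abs_upper_bound_ge0 ab nab))).
by apply: cE.2 => z [->|->].
Qed.

Lemma le0_norm (a b : X) : le 0 a -> le a b -> `|a| <= `|b|.
Proof.
move=> a0 ab; apply: le_norm => //; apply: (bl_trans HBL (y := 0)).
  by apply: (le_shift a0); vec_eq R [:: a].
exact: bl_trans HBL _ _ _ a0 ab.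
Qed.

(** Since [a - l] lies between 0 and [u - l], the triangle inequality applies to
    [a = l + (a - l)]. *)
Lemma le_between_norm (l a u : X) : le l a -> le a u -> `|a| <= 2 * `|l| + `|u|.
Proof.
move=> la au; have -> : a = l + (a - l) by vec_eq R [:: a; l].
apply: le_trans (ler_normD _ _) _.
have : `|a - l| <= `|u - l|.
  by apply: le0_norm; [apply: (le_shift la)|apply: (le_shift au)]; vec_eq R [:: a; l; u].
by have := ler_normB u l; lra.
Qed.

(* The negative part of x is dominated by |z - x| for every z >= 0, hence has
   norm at most `|z - x|. *)
Lemma cone_closed (x : X) :
  (forall e : R, 0 < e -> exists2 z, le 0 z & `|z - x| < e) -> le 0 x.
Proof.
move=> Hx; have [n nE] := bl_sup HBL (- x) 0.
have n_ge0 : le 0 n by apply: nE.1; right.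
suff n0 : n = 0.
  by have /leN := nE.1 (- x) (or_introl erefl); rewrite opprK n0 oppr0.
apply/eqP; rewrite -normr_le0; apply/ler_addgt0Pr => e /Hx[z z0 /ltW ze].
rewrite add0r; apply: le_trans ze; have [c cE] := bl_sup HBL (z - x) (- (z - x)).
apply: (bl_norm HBL (is_lub_abs_ge0 n_ge0) cE); apply: nE.2 => y [->|->].
  apply: (bl_trans HBL (y := z - x)); last by apply: cE.1; left.
  by apply: (le_shift z0); vec_eq R [:: z; x].
by apply: (@abs_upper_bound_ge0 (z - x)); apply: cE.1; [left|right].
Qed.

Section Limits.
Context {T : Type} {F : set_system T} {FF : ProperFilter F}.

Lemma cvg_le (f g : T -> X) (a b : X) :
  f @ F --> a -> g @ F --> b -> (\forall h \near F, le (f h) (g h)) -> le a b.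
Proof.
move=> fa gb fg; suff : le 0 (b - a).
  by move=> H; apply: (le_shift H); vec_eq R [:: a; b].
apply: cone_closed => e e0.
have H : g h - f h @[h --> F] --> b - a by exact: cvgB gb fa.
move/cvgrPdist_lt: H => /(_ _ e0) H.
have [h [leh Hh]] := filter_ex (filterI fg H).
exists (g h - f h); first by apply: (le_shift leh); vec_eq R [:: f h; g h].
by rewrite distrC.
Qed.

Lemma cvg_squeeze (f g k : T -> X) (a : X) :
  f @ F --> a -> k @ F --> a ->
  (\forall h \near F, le (f h) (g h) /\ le (g h) (k h)) -> g @ F --> a.
Proof.
move=> fa ka fgk; have -> : g = f \+ (g \- f).
  by apply/funext => h /=; vec_eq R [:: f h; g h].
rewrite -[a]addr0; apply: cvgD => //; apply: norm_cvg0.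
have kf0 : `|k h - f h| @[h --> F] --> 0.
  by rewrite -(normr0 X) -(subrr a); apply: cvg_norm; exact: cvgB.
apply: (squeeze_cvgr _ (cvg_cst 0) kf0); near=> h.
have [fg gk] : le (f h) (g h) /\ le (g h) (k h) by near: h.
rewrite normr_ge0 /=; apply: le0_norm.
  by apply: (le_shift fg); vec_eq R [:: f h; g h].
by apply: (le_shift gk); vec_eq R [:: f h; g h; k h].
Unshelve. all: by end_near. Qed.

End Limits.

(** Divide by [k + 1] and let [k] tend to infinity; limits preserve the order. *)
Lemma archimedean_le0 (w u : X) : (forall k : nat, le (k%:R *: w) u) -> le w 0.
Proof.
move=> Hw; have u0 : (@harmonic R k *: u) @[k --> \oo] --> 0 *: u.
  by apply: cvgZr_tmp; exact: cvg_harmonic.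
rewrite scale0r in u0; apply: (cvg_le (cvg_cst w) u0).
apply: nearW => k; have H := bl_scale HBL (a := harmonic k) _ (Hw k.+1).
have {}H := H (harmonic_ge0 _).
by apply: (le_shift H); rewrite scalerA /= mulVf // scale1r.
Qed.

Lemma is_glb_unique (A : set X) (a b : X) : is_glb le A a -> is_glb le A b -> a = b.
Proof. by move=> [a1 a2] [b1 b2]; apply: (bl_antisym HBL); [apply: b2|apply: a2]. Qed.

Lemma is_lubN (A : set X) (a : X) : is_glb le A a -> is_lub le [set - x | x in A] (- a).
Proof.
move=> [a1 a2]; split=> [_ [x Ax <-]|u Hu]; first exact/leN/a1.
rewrite -[u]opprK; apply/leN/a2 => x Ax; rewrite -[x]opprK; apply: leN.
by apply: Hu; exists x.
Qed.

Hypothesis HOC : order_continuous_norm le.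

(* The differences q h - v, with v a lower bound of q, form a net decreasing to
   0; hence q is Cauchy at 0+. *)
Lemma monotone_cvg_glb (q : R -> X) (l : X) :
  (forall h k : R, 0 < h -> h <= k -> le (q h) (q k)) ->
  (forall h : R, 0 < h -> le l (q h)) ->
  exists d, is_glb le [set q h | h in [set h : R | 0 < h]] d /\
    q h @[h --> 0^'+] --> d.
Proof.
move=> qmono lq.
pose lower v := forall h : R, 0 < h -> le v (q h).
pose idx := ({h : R | 0 < h} * {v : X | lower v})%type.
pose leI (i j : idx) := sval j.1 <= sval i.1 /\ le (sval i.2) (sval j.2).
pose net (i : idx) := q (sval i.1) - sval i.2.
have net_small : forall eps : R, 0 < eps -> exists a0, forall a, leI a0 a -> `|net a| < eps.
  apply: (HOC (leI := leI)).
  - by move=> a; split=> //; exact: bl_refl HBL _.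
  - move=> a b c [ab1 ab2] [bc1 bc2]; split; first exact: le_trans ab1.
    exact: bl_trans HBL _ _ _ ab2 bc2.
  - move=> [[h h0] [v lv]] [[k k0] [w lw]].
    have [s sE] := bl_sup HBL v w.
    have m0 : 0 < Num.min h k by rewrite lt_min h0.
    have ls : lower s by move=> r r0; apply: sE.2 => z [->|->]; [apply: lv|apply: lw].
    exists (exist _ (Num.min h k) m0, exist _ s ls); rewrite /leI /=.
    by split; split; rewrite ?ge_min ?lexx ?orbT //; apply: sE.1; [left|right].
  - by exists (exist _ 1 ltr01, exist _ l lq).
  - move=> [[h h0] [v lv]] [[k k0] [w lw]] [/= kh vw].
    rewrite /net /=; apply: leD; [exact: qmono|exact: leN].
  - split=> [_ [[[h h0] [v lv]] _ <-]|u Hu].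
      by apply: (le_shift (lv _ h0)); rewrite /net /= subr0.
    (* A lower bound [u] of the net can be added to any lower bound of [q]. Iterating from [l]
       bounds every multiple of [u] by [q 1 - l], so [u] is at most 0. *)
    have Hu' v : lower v -> lower (v + u).
      move=> lv h h0; pose i : idx := (exist _ h h0, exist _ v lv).
      have H : le u (net i) by apply: Hu; exists i.
      by apply: (le_shift H); rewrite /net /=; vec_eq R [:: v; u; q h].
    apply: (@archimedean_le0 _ (q 1 - l)) => k.
    have : lower (l + k%:R *: u).
      elim: k => [|k IH]; first by rewrite scale0r addr0.
      by rewrite -natr1 scalerDl scale1r addrA; exact: Hu'.
    move=> /(_ 1 ltr01) H; apply: (le_shift H); vec_eq R [:: l; u; q 1].
have qC : cauchy (q h @[h --> 0^'+]).
  apply/cauchyP => e e0; have [[[h h0] [v lv]] Hh] := net_small e e0.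
  (* The lower bound [v] itself is the centre of the small ball. *)
  exists v; rewrite /fmap /=; near=> k.
  rewrite -ball_normE /= distrC.
  have k0 : 0 < k by near: k; exact: nbhs_right_gt.
  have kh : k <= h by near: k; exact: nbhs_right_le.
  exact: (Hh (exist _ k k0, exist _ v lv) (conj kh (bl_refl HBL v))).
have [d qd] : exists d : X, q h @[h --> 0^'+] --> d by 
  by exists (lim (q h @[h --> 0^'+])); exact: cauchy_cvg.
exists d; split => //; split=> [_ [h /= h0 <-]|u Hu].
  apply: (cvg_le qd (cvg_cst (q h))); near=> k; apply: qmono; near: k;
    [exact: nbhs_right_gt|exact: nbhs_right_le].
apply: (cvg_le (cvg_cst u) qd); near=> k; apply: Hu; exists k => //=; near: k; exact: nbhs_right_gt.
Unshelve. all: end_near. Qed.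

End BanachLatticeTheory.

(** * Directional derivatives of convex operators *)

Definition diff_quot {R : realType} {X : completeNormedModType R}
    (T : X -> X) (x y : X) (h : R) : X :=
  h^-1 *: (T (x + h *: y) - T x).

(* [ddir le (S t)] is convertible to [dplus le S t]. *)
Definition ddir {R : realType} {X : completeNormedModType R} (le : X -> X -> Prop)
    (T : X -> X) (x y : X) : X :=
  xget 0 (is_glb le [set diff_quot T x y h | h in [set h : R | 0 < h]]).

Definition lipschitz_near {R : realType} {X : completeNormedModType R}
    (T : X -> X) (x : X) (r L : R) :=
  forall y z, `|y - x| <= r -> `|z - x| <= r -> `|T y - T z| <= L * `|y - z|.

Section ConvexOperators.
Context {R : realType} {X : completeNormedModType R} {le : X -> X -> Prop}.
Hypothesis HBL : banach_lattice le.
Implicit Types (T : X -> X) (x y : X).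

Lemma diff_quotN T x y (h : R) : diff_quot T x y (- h) = - diff_quot T x (- y) h.
Proof. by rewrite /diff_quot invrN scaleNr scaleNr scalerN. Qed.

Lemma diff_quotE T x y (h : R) : h != 0 -> T (x + h *: y) = T x + h *: diff_quot T x y h.
Proof. by move=> h0; rewrite /diff_quot scalerA divff // scale1r addrCA subrr addr0. Qed.

(** Prolonging the segment from [z] to [y] by length [r] stays in the ball of radius [2 * r], and
    [y] is a convex combination of [z] and the new endpoint. Exchanging [y] and [z] bounds the
    increment from below. *)
Lemma bounded_convex_lipschitz T x (r M : R) : convex_op le T -> 0 < r ->
  (forall w, `|w - x| <= 2 * r -> `|T w| <= M) ->
  lipschitz_near T x r (6 * M / r).
Proof.
move=> cT r0 TM.
have half y z : `|y - x| <= r -> `|z - x| <= r -> y != z ->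
    exists2 u, `|T u| <= M &
      le (T y - T z) ((`|y - z| / (`|y - z| + r)) *: (T u - T z)).
  move=> yx zx yz; have d0 : 0 < `|y - z| by rewrite normr_gt0 subr_eq0.
  set d := `|y - z| in d0 *.
  have dr0 : 0 < d + r by rewrite addr_gt0.
  exists (y + (r / d) *: (y - z)).
    apply: TM; have -> : y + (r / d) *: (y - z) - x = (y - x) + (r / d) *: (y - z).
      by vec_eq R [:: x; y; z].
    apply: le_trans (ler_normD _ _) _.
    by rewrite normrZ -/d gtr0_norm ?divr_gt0 // divfK ?gt_eqF //; lra.
  have l01 : 0 <= d / (d + r) <= 1.
    by rewrite divr_ge0 ?(ltW d0) ?(ltW dr0) //= ler_pdivrMr // mul1r; lra.
  have := cT _ (y + (r / d) *: (y - z)) z l01.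
  set u := y + _; set Tu := T u.
  have -> : (d / (d + r)) *: u + (1 - d / (d + r)) *: z = y.
    by rewrite /u; vec_eq R [:: y; z].
  by move=> H; apply: (le_shift HBL H); vec_eq R [:: T y; T z; Tu].
move=> y z yx zx; have [->|yz] := eqVneq y z; first by rewrite !subrr !normr0 mulr0.
have d0 : 0 < `|y - z| by rewrite normr_gt0 subr_eq0.
have [u uM uH] := half y z yx zx yz.
have [v vM vH] : exists2 v, `|T v| <= M &
    le (T z - T y) ((`|y - z| / (`|y - z| + r)) *: (T v - T y)).
  by rewrite distrC; apply: half => //; rewrite eq_sym.
have yM : `|T y| <= M by apply: TM; lra.
have zM : `|T z| <= M by apply: TM; lra.
have M0 : 0 <= M by apply: le_trans yM.
set l := _ / _ in uH vH.
have l0 : 0 <= l by rewrite divr_ge0 ?addr_ge0 // ltW.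
have ll : l <= `|y - z| / r.
  by rewrite ler_pM2l // lef_pV2 ?posrE ?addr_gt0 //; lra.
have {}vH := leN HBL vH; rewrite opprB in vH.
(* Both order bounds have norm at most [l * (2 * M)]; the lower one counts twice, whence the factor
   6. *)
apply: le_trans (le_between_norm HBL vH uH) _.
clearbody l; rewrite normrN !normrZ (ger0_norm l0).
have := ler_normB (T v) (T y); have := ler_normB (T u) (T z) => H1 H2.
have -> : 6 * M / r * `|y - z| = (`|y - z| / r) * (6 * M) by ring.
apply: (@le_trans _ _ (l * (6 * M))); last by apply: ler_wpM2r => //; lra.
have : l * `|T v - T y| <= l * (2 * M) by apply: ler_wpM2l => //; lra.
have : l * `|T u - T z| <= l * (2 * M) by apply: ler_wpM2l => //; lra.
lra.
Qed.

Section DirectionalDerivative.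
Variable T : X -> X.
Hypothesis cT : convex_op le T.

Lemma diff_quot_mono x y (h k : R) : 0 < h -> h <= k ->
  le (diff_quot T x y h) (diff_quot T x y k).
Proof.
move=> h0 hk; have k0 : 0 < k by apply: lt_le_trans hk.
have l01 : 0 <= h / k <= 1.
  by rewrite divr_ge0 ?(ltW h0) ?(ltW k0) //= ler_pdivrMr // mul1r.
have := cT (x + k *: y) x l01.
have -> : (h / k) *: (x + k *: y) + (1 - h / k) *: x = x + h *: y.
  by vec_eq R [:: x; y].
have hV : 0 <= h^-1 by rewrite invr_ge0 ltW.
move=> /(bl_scale HBL hV) H; apply: (le_shift HBL H); rewrite /diff_quot.
by vec_eq R [:: T (x + k *: y); T (x + h *: y); T x].
Qed.

(** Monotonicity reduces to the common step [m], where the claim is convexity at the midpoint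
    [x]. *)
Lemma diff_quot_leN x y (h k : R) : 0 < h -> 0 < k ->
  le (diff_quot T x y (- h)) (diff_quot T x y k).
Proof.
move=> h0 k0; pose m := Num.min h k.
have m0 : 0 < m by rewrite lt_min h0.
apply: (bl_trans HBL (y := diff_quot T x y m)); last first.
  by apply: diff_quot_mono => //; rewrite ge_min lexx orbT.
apply: (bl_trans HBL (y := diff_quot T x y (- m))).
  by rewrite !diff_quotN; apply/(leN HBL)/diff_quot_mono; rewrite // ge_min lexx.
have l01 : 0 <= (2^-1 : R) <= 1 by lra.
have := cT (x + m *: y) (x - m *: y) l01.
have -> : 2^-1 *: (x + m *: y) + (1 - 2^-1) *: (x - m *: y) = x.
  by vec_eq R [:: x; y].
have mV : 0 <= 2 * m^-1 by rewrite mulr_ge0 // invr_ge0 ltW.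
move=> /(bl_scale HBL mV) H; apply: (le_shift HBL H).
rewrite /diff_quot scaleNr.
by vec_eq R [:: T (x + m *: y); T (x - m *: y); T x].
Qed.

Hypothesis HOC : order_continuous_norm le.

Lemma ddirP x y :
  is_glb le [set diff_quot T x y h | h in [set h : R | 0 < h]] (ddir le T x y) /\
  diff_quot T x y h @[h --> 0^'+] --> ddir le T x y.
Proof.
have [d [dglb dcvg]] := monotone_cvg_glb HBL HOC
  (@diff_quot_mono x y) (fun h h0 => diff_quot_leN x y ltr01 h0).
suff -> : ddir le T x y = d by [].
by apply: xget_unique => // z zglb; exact: (is_glb_unique HBL zglb dglb).
Qed.

Lemma ddir_cvg x y : diff_quot T x y h @[h --> 0^'+] --> ddir le T x y.
Proof. exact: (ddirP x y).2. Qed.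

Lemma ddir_le x y (h : R) : 0 < h -> le (ddir le T x y) (diff_quot T x y h).
Proof. by move=> h0; apply: (ddirP x y).1.1; exists h. Qed.

(** [- ddir le T x (- y)] stands for the left directional derivative; [dminusE] identifies it with
    [dminus]. *)
Lemma ddirN_ge x y (h : R) : 0 < h -> le (diff_quot T x y (- h)) (- ddir le T x (- y)).
Proof. by move=> h0; rewrite diff_quotN; apply/(leN HBL)/ddir_le. Qed.

Lemma ddirN_le x y : le (- ddir le T x (- y)) (ddir le T x y).
Proof.
apply: (cvg_le HBL (F := 0^'+) (f := fun h : R => - diff_quot T x (- y) h)
                   (g := diff_quot T x y)).
- by apply: cvgN; exact: ddir_cvg.
- exact: ddir_cvg.
- near=> h; rewrite -diff_quotN.
  have h0 : 0 < h by near: h; exact: nbhs_right_gt.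
  exact: diff_quot_leN.
Unshelve. all: end_near. Qed.

(** Replacing the direction [y] by [w h] changes the quotient by at most [L * |w h - y|], so
    perturbations of size o(h) are harmless. *)
Lemma ddir_lipschitz_cvg x y (r L : R) (w : R -> X) :
  0 < r -> lipschitz_near T x r L -> w h @[h --> 0^'+] --> y ->
  h^-1 *: (T (x + h *: w h) - T x) @[h --> 0^'+] --> ddir le T x y.
Proof.
move=> r0 LT wy.
have hid : h @[h --> (0 : R)^'+] --> (0 : R) by apply: cvg_at_right_filter; exact: cvg_id.
have small (v : R -> X) : v h @[h --> 0^'+] --> y ->
    \forall h \near 0^'+, `|x + h *: v h - x| <= r.
  move=> vy; have hv : h *: v h @[h --> 0^'+] --> 0 *: y by exact: cvgZ.
  rewrite scale0r in hv; move/cvgrPdist_le: hv => /(_ _ r0); apply: filterS => h.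
  by rewrite sub0r normrN addrAC subrr add0r.
have -> : (fun h => h^-1 *: (T (x + h *: w h) - T x)) =
    diff_quot T x y \+ (fun h => h^-1 *: (T (x + h *: w h) - T (x + h *: y))).
  by apply/funext => h /=; rewrite /diff_quot;
    vec_eq R [:: T (x + h *: w h); T (x + h *: y); T x].
rewrite -[ddir _ _ _ _]addr0; apply: cvgD; first exact: ddir_cvg.
apply: norm_cvg0.
have wy0 : L * `|w h - y| @[h --> 0^'+] --> L * `|y - y|.
  by apply: cvgMr; apply: cvg_norm; apply: cvgB => //; exact: cvg_cst.
rewrite subrr normr0 mulr0 in wy0.
apply: (squeeze_cvgr _ (cvg_cst 0) wy0); near=> h.
have h0 : 0 < h by near: h; exact: nbhs_right_gt.
rewrite normr_ge0 /= normrZ gtr0_norm ?invr_gt0 // mulrC ler_pdivrMr //.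
have Hw : `|x + h *: w h - x| <= r by near: h; exact: small.
have Hy : `|x + h *: y - x| <= r by near: h; apply: small; exact: cvg_cst.
apply: le_trans (LT _ _ Hw Hy) _.
have -> : x + h *: w h - (x + h *: y) = h *: (w h - y).
  by vec_eq R [:: x; w h; y].
by rewrite normrZ gtr0_norm // mulrA mulrAC.
Unshelve. all: end_near. Qed.

End DirectionalDerivative.

(** Chain rule: the difference quotient of [T2] is the moving direction fed to [T1]. *)
Lemma ddir_comp T1 T2 T3 x y (r L : R) : order_continuous_norm le ->
  convex_op le T1 -> convex_op le T2 -> convex_op le T3 ->
  (forall z, T3 z = T1 (T2 z)) -> 0 < r -> lipschitz_near T1 (T2 x) r L ->
  ddir le T3 x y = ddir le T1 (T2 x) (ddir le T2 x y).
Proof.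
move=> HOC c1 c2 c3 T12 r0 L1.
have H1 :=
  ddir_lipschitz_cvg c1 HOC r0 L1 (ddir_cvg c2 HOC (x := x) (y := y)).
have H3 := ddir_cvg c3 HOC (x := x) (y := y).
apply: (cvg_unique_near H3 H1); near=> h.
have h0 : h != 0 by rewrite gt_eqF //; near: h; exact: nbhs_right_gt.
by rewrite -diff_quotE // /diff_quot !T12.
Unshelve. all: end_near. Qed.

End ConvexOperators.

(** * One-sided calculus *)

Lemma near_right0P {R : realType} (P : R -> Prop) :
  (\forall h \near 0^'+, P h) <->
  exists2 d : R, 0 < d & forall h, 0 < h -> h < d -> P h.
Proof.
split=> [/nbhs_ballP[d /= d0 Hd]|[d d0 Hd]].
  exists d => // h h0 hd; apply: Hd => //=.
  by rewrite /ball /= sub0r normrN gtr0_norm.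
near=> h; apply: Hd; near: h; [exact: nbhs_right_gt|exact: nbhs_right_lt].
Unshelve. all: end_near. Qed.

Section Calculus.
Context {R : realType} {X : normedModType R}.
Implicit Types (u F : R -> X).

(** Continuous induction: [E] collects the points up to which the estimate holds with a slope
    [k > e]. Left continuity puts its supremum in [E], and the right derivative would push it
    further if it were below [b]. *)
Lemma right_derivative_mean_value u F (c : X) (e a b : R) : a <= b ->
  (forall s, a < s <= b -> u (s - h) @[h --> 0^'+] --> u s) ->
  (forall s, a <= s < b -> h^-1 *: (u (s + h) - u s) @[h --> 0^'+] --> F s) ->
  (forall s, a <= s < b -> `|F s - c| <= e) ->
  `|u b - u a - (b - a) *: c| <= e * (b - a).
Proof.
move=> ab uL uD Fc; apply/ler_addgt0Pr => e' e'0.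
have [->|nab] := eqVneq a b.
  by rewrite !subrr scale0r subrr normr0 mulr0 add0r ltW.
have ltab : 0 < b - a by rewrite subr_gt0 lt_neqAle nab.
(* The gap [k - e] absorbs the error of the difference quotient and costs only [e'] over the whole
   interval. *)
pose k := e + e' / (b - a).
have -> : e * (b - a) + e' = k * (b - a) by rewrite /k mulrDl divfK // gt_eqF.
have ek : e < k by rewrite ltrDl divr_gt0.
pose P s := `|u s - u a - (s - a) *: c| <= k * (s - a).
pose E := [set s | a <= s <= b /\ forall r, a <= r <= s -> P r].
have Pa : P a by rewrite /P !subrr scale0r subrr normr0 mulr0.
have Ea : E a.
  by split=> [|r]; [rewrite lexx|rewrite -eq_le => /eqP <-].
have supE : has_sup E by split; [exists a|exists b => s [/andP[]]].
set m := sup E.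
have am : a <= m by apply: ub_le_sup => //; case: supE.
have mb : m <= b by apply: ge_sup; [exists a|move=> s [/andP[]]].
have Pltm r : a <= r -> r < m -> P r.
  move=> ar rm; have rm0 : 0 < m - r by rewrite subr_gt0.
  have [s [_ Es] rs] := sup_adherent rm0 supE.
  by apply: Es; rewrite ar /=; rewrite -/m in rs; lra.
have Pm : P m.
  move: am; rewrite le_eqVlt => /predU1P[<- //|am].
  have hid : m - h - a @[h --> (0 : R)^'+] --> m - 0 - a.
    apply: cvgB; last exact: cvg_cst.
    apply: cvgB; first exact: cvg_cst.
    by apply: cvg_at_right_filter; exact: cvg_id.
  rewrite subr0 in hid.
  have uLm : u (m - h) @[h --> 0^'+] --> u m by apply: uL; rewrite am mb.
  apply: (ler_cvg_to (a := (0 : R)^'+)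
    (f := fun h => `|u (m - h) - u a - (m - h - a) *: c|)
    (g := fun h => k * (m - h - a))).
  - apply: cvg_norm; apply: cvgB; last exact: cvgZr_tmp.
    by apply: cvgB => //; exact: cvg_cst.
  - exact: cvgMr.
  - near=> h; apply: Pltm.
      have : h <= m - a by near: h; apply: nbhs_right_le; rewrite subr_gt0.
      lra.
    have : 0 < h by near: h; exact: nbhs_right_gt.
    lra.
have [mb'|] := ltP m b; last first.
  by move=> bm; have <- : m = b by apply/eqP; rewrite eq_le mb bm.
have amb : a <= m < b by rewrite am mb'.
have ke0 : 0 < k - e by rewrite subr_gt0.
have /cvgrPdist_le/(_ _ ke0)/near_right0P[d d0 Hd] := uD m amb.
pose h := Num.min (d / 2) (b - m).
have h0 : 0 < h by rewrite lt_min divr_gt0 //= subr_gt0.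
have hd : h <= d / 2 by rewrite ge_min lexx.
have hb : h <= b - m by rewrite ge_min lexx orbT.
suff /(ub_le_sup supE.2) : E (m + h) by rewrite -/m; lra.
split=> [|r /andP[ar rmh]]; first by lra.
have [rm|mr] := leP r m.
  move: rm; rewrite le_eqVlt => /predU1P[-> //|]; exact: Pltm.
have [l rE] : exists l, r = m + l by exists (r - m); ring.
subst r; rewrite /P; have l0 : 0 < l by lra.
have ld : l < d by lra.
have Fm := Fc m amb; have Hl := Hd l l0 ld.
(* The three terms are bounded by [k * (m - a)], [l * (k - e)] and [l * e]. *)
have -> : u (m + l) - u a - (m + l - a) *: c = (u m - u a - (m - a) *: c)
    - l *: (F m - l^-1 *: (u (m + l) - u m)) + l *: (F m - c).
  by vec_eq R [:: u (m + l); u m; u a; c; F m].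
apply: le_trans (ler_normD _ _) _; rewrite normrZ gtr0_norm //.
apply: (@le_trans _ _ (k * (m - a) + l * (k - e) + l * e)); last first.
  by rewrite le_eqVlt; apply/orP; left; apply/eqP; ring.
apply: lerD; last by rewrite ler_pM2l.
apply: le_trans (ler_normB _ _) _; apply: lerD => //.
by rewrite normrZ gtr0_norm // ler_pM2l.
Unshelve. all: end_near. Qed.

(** Heine-Cantor: the near-covering form of compactness turns radii valid near each point into a
    common one. *)
Lemma within_unif_continuous F (a b e : R) :
  {within `[a, b], continuous F} -> 0 < e ->
  exists2 d : R, 0 < d & forall s r, a <= s <= b -> a <= r <= b ->
    `|s - r| < d -> `|F s - F r| < e.
Proof.
move=> /subspace_continuousP cF e0.
pose P (d s : R) := a <= s <= b -> forall r, a <= r <= b -> `|s - r| < d -> `|F s - F r| < e.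
have : forall s, `[a, b]%classic s -> \forall s' \near s & d \near 0^'+, P d s'.
  move=> s sab; have e2 : 0 < e / 2 by rewrite divr_gt0.
  have /cvgrPdist_lt/(_ _ e2)/nbhs_ballP[d /= d0 Hd] := cF s sab.
  exists (ball s (d / 2), [set h : R | h < d / 2]).
    split => /=; first by apply: nbhsx_ballx; rewrite divr_gt0.
    by apply: nbhs_right_lt; rewrite divr_gt0.
  move=> [s' h] /= [ss' hd] s'ab r rab s'r.
  have -> : F s' - F r = (F s - F r) - (F s - F s') by vec_eq R [:: F s; F s'; F r].
  have := ler_normB (F s - F r) (F s - F s').
  rewrite /ball /= in ss'.
  have H1 : `|F s - F s'| < e / 2.
    by apply: Hd; rewrite /= ?in_itv //= /ball /=; lra.
  have H2 : `|F s - F r| < e / 2.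
    apply: Hd; rewrite /= ?in_itv //= /ball /=.
    by have := ler_normD (s - s') (s' - r); rewrite addrA subrK; lra.
  lra.
have /compact_near_coveringP cov := @segment_compact R a b.
move=> /(cov R 0^'+ P _)/(near_right0P (fun d => `[a, b]%classic `<=` P d))[d d0 Hd].
exists (d / 2); first by rewrite divr_gt0.
move=> s r sab rab; apply: (Hd (d / 2)) => //; lra.
Qed.

(** On each cell of a fine partition [F] is close to its value at the tag, so the mean value
    inequality bounds the error; the increments of [u] telescope. *)
Lemma riemann_integral_right_derivative u F (a b : R) : a <= b ->
  (forall s, a < s <= b -> u (s - h) @[h --> 0^'+] --> u s) ->
  (forall s, a <= s < b -> h^-1 *: (u (s + h) - u s) @[h --> 0^'+] --> F s) ->
  {within `[a, b], continuous F} ->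
  is_riemann_integral F a b (u b - u a).
Proof.
move=> ab uL uD cF e e0.
(* The [+ 1] covers the case [a = b] and makes the final inequality strict. *)
have e'0 : 0 < e / (b - a + 1) by rewrite divr_gt0 // ltr_wpDl // subr_ge0.
have [d d0 Hd] := within_unif_continuous cF e'0.
exists d => // n p q pa pb Hpq.
have pS i : (i < n)%N -> p i <= p i.+1.
  by move=> /Hpq[/andP[pq qp] _]; exact: le_trans qp.
have pge i : (i <= n)%N -> a <= p i.
  elim: i => [_|i IH lin]; first by rewrite pa.
  exact: le_trans (IH (ltnW lin)) (pS i lin).
have ple i : (i <= n)%N -> p (n - i)%N <= b.
  elim: i => [_|i IH lin]; first by rewrite subn0 pb.
  apply: le_trans (IH (ltnW lin)); rewrite -(subnSK lin); apply: pS.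
  by rewrite ltn_subrL (leq_trans _ lin).
have {}ple i : (i <= n)%N -> p i <= b.
  by move=> lin; rewrite -(subKn lin); apply: ple; exact: leq_subr.
have uE : u b - u a = \sum_(i < n) (u (p i.+1) - u (p i)).
  by rewrite -pa -pb -(telescope_sumr (fun i => u (p i))) // big_mkord.
have lE : b - a = \sum_(i < n) (p i.+1 - p i).
  by rewrite -{1}pb -{1}pa -(telescope_sumr p) // big_mkord.
rewrite uE -sumrB.
apply: (@le_lt_trans _ _ (\sum_(i < n) e / (b - a + 1) * (p i.+1 - p i))); last first.
  rewrite -mulr_sumr -lE mulrAC ltr_pdivrMr; last by rewrite ltr_wpDl // subr_ge0.
  by rewrite ltr_pM2l //; lra.
apply: le_trans (ler_norm_sum _ _ _) _; apply: ler_sum => i _.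
have [/andP[pq qp] lti] := Hpq i (ltn_ord i).
have api := pge i (ltnW (ltn_ord i)); have pib := ple _ (ltn_ord i).
rewrite distrC; apply: (@right_derivative_mean_value u F) => [|s|s|s].
- exact: pS.
- by move=> /andP[? ?]; apply: uL; lra.
- by move=> /andP[? ?]; apply: uD; lra.
- move=> /andP[? ?]; apply/ltW/Hd; [lra|lra|].
  by rewrite ltr_norml; apply/andP; split; lra.
Qed.

End Calculus.

(** * Uniform boundedness for convex operators *)

Section UniformBoundedness.
Context {R : realType} {X : completeNormedModType R} {le : X -> X -> Prop}.
Hypothesis HBL : banach_lattice le.

Lemma bounded_op_lipschitz_near (T : X -> X) (x : X) :
  convex_op le T -> bounded_op T ->
  exists2 r : R, 0 < r & exists L, lipschitz_near T x r L.
Proof.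
move=> cT bT; have nx : 0 < `|x| + 2 by rewrite ltr_wpDl.
have [M TM] := bT _ nx; exists 1 => //; exists (6 * M / 1).
apply: (bounded_convex_lipschitz HBL cT) => // w wx; apply: TM.
by have := ler_normD (w - x) x; rewrite subrK; lra.
Qed.

Lemma lipschitz_near_cvg (T : X -> X) (x : X) (r L : R) {I : Type} (F : set_system I)
    {FF : Filter F} (w : I -> X) :
  0 < r -> lipschitz_near T x r L -> w @ F --> x -> T (w i) @[i --> F] --> T x.
Proof.
move=> r0 LT wx; have LTw : \forall i \near F, `|T x - T (w i)| <= `|L| * `|x - w i|.
  move/cvgrPdist_le : (wx) => /(_ _ r0); apply: filterS => i xw.
  have xx : `|x - x| <= r by rewrite subrr normr0 ltW.
  have wir : `|w i - x| <= r by rewrite distrC.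
  apply: le_trans (LT x (w i) xx wir) _.
  by apply: ler_wpM2r => //; exact: ler_norm.
apply/cvgrPdist_lt => e e0; have e'0 : 0 < e / (`|L| + 1) by rewrite divr_gt0 // ltr_wpDl.
move/cvgrPdist_lt : wx => /(_ _ e'0) wx.
apply: filterS2 LTw wx => i H1 H2; apply: le_lt_trans H1 _.
rewrite ltr_pdivlMr ?ltr_wpDl // in H2; apply: le_lt_trans H2.
by rewrite mulrC ler_wpM2l //; lra.
Qed.

Lemma bounded_convex_continuous (T : X -> X) :
  convex_op le T -> bounded_op T -> continuous T.
Proof.
move=> cT bT x; have [r r0 [L LT]] := bounded_op_lipschitz_near x cT bT.
exact: (lipschitz_near_cvg r0 LT).
Qed.

(* Baire gives a ball on which the family is bounded; every x is the midpoint of the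
   centre of that ball and some x1, so convexity yields an upper bound near x,
   and reflection through x turns it into a lower bound. *)
Lemma convex_uniform_boundedness (F : set (X -> X)) :
  (forall f, F f -> convex_op le f /\ bounded_op f) ->
  (forall x, exists M : R, forall f, F f -> `|f x| <= M) ->
  forall x, exists2 r : R, 0 < r & exists M : R, forall f, F f ->
    forall w, `|w - x| <= r -> `|f w| <= M.
Proof.
move=> FT pF x.
pose O n := \bigcup_(f in F) [set y : X | n%:R < `|f y|].
have O_open n : open (O n).
  apply: bigcup_open => f /FT[cf bf].
  apply: (open_comp (f := fun y => `|f y|) (D := [set z : R | n%:R < z])) => [y _|].
    by apply: cvg_norm; exact: bounded_convex_continuous.
  exact: open_gt.
(* If every [O n] were dense, Baire would give a point in all of them, against the pointwise
   bound. *)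
have [n [x0 [r r0 Hr]]] : exists n x0, exists2 r : R, 0 < r &
    forall w, ball x0 r w -> forall f, F f -> `|f w| <= n%:R.
  have [n nO] : exists n, ~ dense (O n).
    apply: contrapT => dO.
    have : dense (\bigcap_n (O n)).
      by apply: Baire => n; split=> //; apply: contrapT => nO; apply: dO; exists n.
    move=> /(_ setT)[||y [_ Oy]]; [by exists 0|exact: openT|].
    have [M yM] := pF y; have [f Ff] := Oy (Num.truncn M).+1 I.
    apply/negP; rewrite -leNgt; exact: le_trans (yM f Ff) (ltW (truncnS_gt M)).
  move: nO => /denseNE[U [[x0 /open_nbhs_nbhs/nbhs_ballP[r r0 bU]] UO]].
  exists n, x0, r => // w /bU Uw f Ff; rewrite leNgt; apply/negP => fw.
  have : (U `&` O n) w by split=> //; exists f.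
  by rewrite UO.
have [M1 HM1] := pF (x + (x - x0)); have [M HM] := pF x.
exists (r / 4); first by rewrite divr_gt0.
pose B := 2^-1 * n%:R + 2^-1 * M1.
exists (2 * (2 * M + B) + B) => f Ff w wx; have [cf bf] := FT f Ff.
(* [w] is the midpoint of [x0 + 2 (w - x)] and the reflection of [x0] through [x]. The radius
   [r / 4] keeps the former within [r / 2] of [x0]. *)
pose U w := 2^-1 *: f (x0 + 2 *: (w - x)) + (1 - 2^-1) *: f (x + (x - x0)).
have half01 : 0 <= (2^-1 : R) <= 1 by lra.
have fU v : le (f v) (U v).
  have := cf _ (x0 + 2 *: (v - x)) (x + (x - x0)) half01.
  by have -> : 2^-1 *: (x0 + 2 *: (v - x)) + (1 - 2^-1) *: (x + (x - x0)) = v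
    by vec_eq R [:: x0; v; x].
have UB v : `|v - x| <= r / 4 -> `|U v| <= B.
  move=> vx; apply: le_trans (ler_normD _ _) _; rewrite !normrZ.
  rewrite !gtr0_norm; [|lra|lra]; apply: lerD.
    rewrite ler_pM2l ?invr_gt0 //; apply: (Hr _ _ _ Ff); rewrite -ball_normE /ball_ /=.
    by rewrite opprD addrA subrr sub0r normrN normrZ gtr0_norm //; lra.
  have -> : 1 - 2^-1 = 2^-1 :> R by lra.
  by rewrite ler_pM2l ?invr_gt0 //; exact: HM1.
have rx : `|x + (x - w) - x| <= r / 4 by rewrite addrAC subrr add0r distrC.
have low : le (2 *: f x - U (x + (x - w))) (f w).
  have := cf _ w (x + (x - w)) half01.
  have -> : 2^-1 *: w + (1 - 2^-1) *: (x + (x - w)) = x by vec_eq R [:: w; x].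
  set w' := x + (x - w).
  move=> /(bl_scale HBL (ler0n R 2)) H; have {H} := leD HBL H (fU w').
  move=> H; apply: (le_shift HBL H).
  by vec_eq R [:: f x; f w; f w'; U w'].
apply: le_trans (le_between_norm HBL low (fU w)) _.
have := UB _ wx; have := UB _ rx; have := HM f Ff.
have := ler_normB (2 *: f x) (U (x + (x - w))).
rewrite normrZ ger0_norm //; lra.
Qed.

End UniformBoundedness.

(** * Orbits of a convex semigroup *)

Section Semigroup.
Context {R : realType} {X : completeNormedModType R} {le : X -> X -> Prop}.
Variable S : R -> X -> X.
Hypotheses (HBL : banach_lattice le) (HOC : order_continuous_norm le).
Hypothesis HS : convex_C0_semigroup le S.

(** Continuity at 0 bounds the orbit on some [[0, h]]; the bounded operator [S h] then extends the
    bound by [h] at a time. *)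
Lemma orbit_bounded (t0 : R) (x : X) :
  exists M : R, forall t, 0 <= t <= t0 -> `|S t x| <= M.
Proof.
case: HS => bS _ S0 SD Sx.
have /cvgrPdist_le/(_ 1 ltr01)/near_right0P[d d0 Hd] := Sx x.
pose h := d / 2; have h0 : 0 < h by rewrite divr_gt0.
have hd : h < d by rewrite /h; lra.
have first t : 0 <= t <= h -> `|S t x| <= `|x| + 1.
  move=> /andP[]; rewrite le_eqVlt => /predU1P[<- _|t0' th]; first by rewrite S0; lra.
  have := Hd t t0' (le_lt_trans th hd).
  by have := ler_normB x (x - S t x); rewrite opprB addrCA subrr addr0; lra.
have [n nt0] : exists n : nat, t0 <= n%:R * h.
  exists (Num.truncn (t0 / h)).+1; rewrite -ler_pdivrMr //.
  exact/ltW/truncnS_gt.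
suff [M HM] : exists M : R, forall t, 0 <= t <= n%:R * h -> `|S t x| <= M.
  by exists M => t /andP[t1 t2]; apply: HM; rewrite t1 (le_trans t2).
elim: n {nt0} => [|n [M HM]].
  by exists (`|x| + 1) => t /andP[t1 t2]; apply: first; rewrite mul0r in t2; lra.
have M1 : 0 < `|M| + 1 by rewrite ltr_wpDl.
have [M' HM'] := bS h (ltW h0) _ M1.
exists (`|x| + 1 + `|M'|) => t /andP[t1 t2]; have [th|ht] := leP t h.
  by apply: (le_trans (first t _)); rewrite ?t1 // lerDl.
have -> : t = h + (t - h) by ring.
rewrite SD ?subr_ge0 ?(ltW h0) ?(ltW ht) //.
have : `|S (t - h) x| <= M by apply: HM; rewrite -natr1 mulrDl mul1r in t2; lra.
move=> H; have {}H : `|S (t - h) x| <= `|M| + 1 by have := ler_norm M; lra.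
by have := HM' _ H; have := ler_norm M'; have := normr_ge0 x; lra.
Qed.

(** Limits from the left involve [S (t - h)] with varying [h], so one constant must serve all times
    up to [t0]. *)
Lemma uniform_lipschitz_near (t0 : R) (x : X) :
  exists2 r : R, 0 < r & exists L : R,
    forall t, 0 <= t <= t0 -> lipschitz_near (S t) x r L.
Proof.
case: (HS) => bS cS _ _ _.
pose F := [set S t | t in [set t | 0 <= t <= t0]].
have [||r r0 [M HM]] := @convex_uniform_boundedness _ _ _ HBL F _ _ x.
- by move=> _ [t /= /andP[t1 _] <-]; split; [exact: cS|exact: bS].
- move=> z; have [M HM] := orbit_bounded t0 z.
  by exists M => _ [t /= tt0 <-]; exact: HM.
exists (r / 2); first by rewrite divr_gt0.
exists (6 * M / (r / 2)) => t tt0.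
apply: (bounded_convex_lipschitz HBL); first by apply: cS; case/andP: tt0.
  by rewrite divr_gt0.
by move=> w wx; apply: (HM (S t)); [exists t|lra].
Qed.

Lemma orbit_cvg_right (t : R) (x : X) : 0 <= t -> S (t + h) x @[h --> 0^'+] --> S t x.
Proof.
move=> t0; case: (HS) => bS cS _ SD Sx.
have [r r0 [L LT]] := bounded_op_lipschitz_near HBL x (cS t t0) (bS t t0).
apply: (cvg_trans (near_eq_cvg _) (lipschitz_near_cvg r0 LT (Sx x))).
near=> h; rewrite SD //; apply/ltW; near: h; exact: nbhs_right_gt.
Unshelve. all: end_near. Qed.

(** Write [S t x] as [S (t - h) (S h x)] and use a Lipschitz constant independent of [h]. *)
Lemma orbit_cvg_left (t : R) (x : X) : 0 < t -> S (t - h) x @[h --> 0^'+] --> S t x.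
Proof.
move=> t0; case: (HS) => _ _ _ SD Sx.
have [r r0 [L LT]] := uniform_lipschitz_near t x.
have Lx : L * `|S h x - x| @[h --> 0^'+] --> L * `|x - x|.
  by apply: cvgMr; apply: cvg_norm; apply: cvgB; [exact: Sx|exact: cvg_cst].
rewrite subrr normr0 mulr0 in Lx.
apply/cvgrPdist_le => e e0.
have /cvgrPdist_le/(_ _ r0) := Sx x; move/cvgrPdist_le : Lx => /(_ _ e0).
apply: filter_app2; near=> h => H1 H2.
have h0 : 0 < h by near: h; exact: nbhs_right_gt.
have ht : h <= t by near: h; exact: nbhs_right_le.
have {1}-> : S t x = S (t - h) (S h x) by rewrite -SD ?subrK ?(ltW h0) // subr_ge0.
have Lth : lipschitz_near (S (t - h)) x r L by apply: LT; lra.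
have xx : `|x - x| <= r by rewrite subrr normr0 ltW.
rewrite distrC in H2; apply: le_trans (Lth _ _ H2 xx) _.
by move: H1; rewrite sub0r normrN; apply: le_trans; exact: ler_norm.
Unshelve. all: end_near. Qed.

(** The quotients of [S h] with the fixed steps -1 and 1 both tend to [y] by strong continuity. *)
Lemma diff_quot_squeeze_cvg (x y : X) (g : R -> X) :
  (\forall h \near 0^'+, le (diff_quot (S h) x y (- 1)) (g h) /\
                         le (g h) (diff_quot (S h) x y 1)) ->
  g h @[h --> 0^'+] --> y.
Proof.
case: (HS) => _ _ _ _ Sx; apply: (cvg_squeeze HBL).
  have -> : (fun h => diff_quot (S h) x y (- 1)) = (fun h => S h x - S h (x - y)).
    by apply/funext => h; rewrite /diff_quot invrN invr1 !scaleN1r opprB.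
  rewrite -[X in _ --> X](_ : x - (x - y) = y); last by vec_eq R [:: x; y].
  by apply: cvgB; exact: Sx.
have -> : (fun h => diff_quot (S h) x y 1) = (fun h => S h (x + y) - S h x).
  by apply/funext => h; rewrite /diff_quot invr1 !scale1r.
rewrite -[X in _ --> X](_ : x + y - x = y); last by vec_eq R [:: x; y].
by apply: cvgB; exact: Sx.
Qed.

Lemma ddir_semigroup_cvg (x y : X) : ddir le (S h) x y @[h --> 0^'+] --> y.
Proof.
case: (HS) => _ cS _ _ _; apply: (@diff_quot_squeeze_cvg x); near=> h.
have h0 : 0 <= h by apply/ltW; near: h; exact: nbhs_right_gt.
have ch := cS h h0; split; last exact: ddir_le.
exact: bl_trans HBL _ _ _ (ddirN_ge HBL ch HOC x y ltr01) (ddirN_le HBL ch HOC x y).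
Unshelve. all: end_near. Qed.

(** The chain rule for [S h] after [S t] reduces this to time 0, at the point [S t x] in direction
    [ddir le (S t) x y]. *)
Lemma ddir_right_continuous (x y : X) (t : R) : 0 <= t ->
  ddir le (S (t + h)) x y @[h --> 0^'+] --> ddir le (S t) x y.
Proof.
case: (HS) => bS cS _ SD _ t0.
apply: cvg_trans (@ddir_semigroup_cvg (S t x) (ddir le (S t) x y)).
apply: near_eq_cvg; near=> h.
have h0 : 0 <= h by apply/ltW; near: h; exact: nbhs_right_gt.
have [r r0 [L LT]] := bounded_op_lipschitz_near HBL (S t x) (cS h h0) (bS h h0).
apply/esym; apply: (ddir_comp HBL _ HOC (cS h h0) (cS t t0) _ _ r0 LT).
  by apply: cS; rewrite addr_ge0.
by move=> z; rewrite addrC SD.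
Unshelve. all: end_near. Qed.

Section Orbit.
Variables x y : X.
Hypothesis xy : gen S x y.

(** The quotient [(S h x - x) / h], which tends to [y], serves as moving direction for [S t]. *)
Lemma orbit_right_derivative (t : R) : 0 <= t ->
  h^-1 *: (S (t + h) x - S t x) @[h --> 0^'+] --> ddir le (S t) x y.
Proof.
case: (HS) => bS cS _ SD _ t0.
have [r r0 [L LT]] := bounded_op_lipschitz_near HBL x (cS t t0) (bS t t0).
have := ddir_lipschitz_cvg HBL (cS t t0) HOC r0 LT xy.
apply: cvg_trans; apply: near_eq_cvg; near=> h.
have h0 : 0 < h by near: h; exact: nbhs_right_gt.
rewrite SD ?(ltW h0) // scalerA divff ?gt_eqF // scale1r.
by rewrite addrCA subrr addr0.
Unshelve. all: end_near. Qed.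

Lemma gen_orbit (t : R) : 0 <= t -> gen S (S t x) (ddir le (S t) x y).
Proof.
case: (HS) => _ _ _ SD _ t0.
apply: cvg_trans (orbit_right_derivative t0); apply: near_eq_cvg; near=> h.
have h0 : 0 < h by near: h; exact: nbhs_right_gt.
by rewrite [t + h]addrC SD // ltW.
Unshelve. all: end_near. Qed.

(** Both [(S h x - x) / h] and [(S h x - S h (x - h y)) / h] tend to [y]; subtract them. *)
Lemma semigroup_backward_step :
  h^-1 *: (S h (x - h *: y) - x) @[h --> 0^'+] --> 0.
Proof.
case: (HS) => _ cS _ _ _.
have q : diff_quot (S h) x y (- h) @[h --> 0^'+] --> y.
  apply: (@diff_quot_squeeze_cvg x); near=> h.
  have h0 : 0 < h by near: h; exact: nbhs_right_gt.
  have h1 : h <= 1 by near: h; exact: nbhs_right_le.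
  have ch := cS h (ltW h0); split; last exact: diff_quot_leN.
  by rewrite !diff_quotN; apply/(leN HBL)/diff_quot_mono.
have H : h^-1 *: (S h x - x) - diff_quot (S h) x y (- h) @[h --> 0^'+] --> y - y.
  exact: cvgB xy q.
rewrite subrr in H; apply: cvg_trans H; apply: near_eq_cvg; near=> h.
rewrite /diff_quot invrN !scaleNr.
by vec_eq R [:: S h x; x; S h (x - h *: y)].
Unshelve. all: end_near. Qed.

(** Insert [S t (x - h y)]. Its difference with [S t x] gives the derivative; its difference with
    [S (t - h) x] is o(h) by [semigroup_backward_step] and the uniform Lipschitz bound on
    [S (t - h)]. *)
Lemma orbit_left_derivative (t : R) : 0 < t ->
  h^-1 *: (S t x - S (t - h) x) @[h --> 0^'+] --> - ddir le (S t) x (- y).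
Proof.
case: (HS) => bS cS _ SD _ t0.
have ct := cS t (ltW t0).
have [r r0 [L LT]] := uniform_lipschitz_near t x.
pose b h := h^-1 *: (S h (x - h *: y) - x).
have b0 : b h @[h --> 0^'+] --> 0 by exact: semigroup_backward_step.
pose c h := h^-1 *: (S (t - h) (S h (x - h *: y)) - S (t - h) x).
have c0 : c h @[h --> 0^'+] --> 0.
  apply: norm_cvg0; have Lb : L * `|b h| @[h --> 0^'+] --> L * `|0 : X|.
    by apply: cvgMr; exact: cvg_norm.
  rewrite normr0 mulr0 in Lb; apply: (squeeze_cvgr _ (cvg_cst 0) Lb).
  have hb : h *: b h @[h --> 0^'+] --> (0 : R) *: (0 : X).
    by apply: cvgZ => //; apply: cvg_at_right_filter; exact: cvg_id.
  rewrite scale0r in hb; move/cvgrPdist_le : hb => /(_ _ r0).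
  apply: filter_app; near=> h => hb.
  have h0 : 0 < h by near: h; exact: nbhs_right_gt.
  have ht : h <= t by near: h; exact: nbhs_right_le.
  rewrite sub0r normrN /b scalerA divff ?gt_eqF // scale1r in hb.
  have Lth : lipschitz_near (S (t - h)) x r L by apply: LT; lra.
  have xx : `|x - x| <= r by rewrite subrr normr0 ltW.
  rewrite normr_ge0 /= /c /b !normrZ mulrCA ler_wpM2l //.
  exact: Lth hb xx.
have d : - diff_quot (S t) x (- y) h @[h --> 0^'+] --> - ddir le (S t) x (- y).
  by apply: cvgN; exact: ddir_cvg.
have H : - diff_quot (S t) x (- y) h + c h @[h --> 0^'+] -->
  - ddir le (S t) x (- y) + 0 by exact: cvgD d c0.
rewrite addr0 in H; apply: cvg_trans H; apply: near_eq_cvg; near=> h; rewrite /c.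
have h0 : 0 < h by near: h; exact: nbhs_right_gt.
have ht : h <= t by near: h; exact: nbhs_right_le.
rewrite -SD ?subrK ?(ltW h0) ?subr_ge0 // /diff_quot scalerN.
by vec_eq R [:: S t x; S t (x - h *: y); S (t - h) x].
Unshelve. all: end_near. Qed.

(* Both sides are right-continuous in t, and the mean value inequality for right
   derivatives bounds the left derivative at t + h by the values of the right
   derivative on [t, t + h[. *)
Lemma ddir_orbitE (t : R) : 0 <= t -> ddir le (S t) x y = - ddir le (S t) x (- y).
Proof.
move=> t0; pose f s := ddir le (S s) x y; pose g s := - ddir le (S s) x (- y).
have ft : f (t + h) @[h --> 0^'+] --> f t by exact: ddir_right_continuous.
have gt : g (t + h) @[h --> 0^'+] --> g t by apply: cvgN; exact: ddir_right_continuous.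
suff gf : g (t + h) @[h --> 0^'+] --> f t.
  by apply: (cvg_unique_near gf gt); exact: nearW.
apply/cvgrPdist_le => e e0; apply/near_right0P.
move/cvgrPdist_le : ft => /(_ _ e0)/near_right0P[d d0 Hd].
exists d => // h h0 hd; pose b := t + h.
have fe s : t <= s < b -> `|f s - f t| <= e.
  move=> /andP[]; rewrite le_eqVlt => /predU1P[<- _|ts sb].
    by rewrite subrr normr0 ltW.
  have -> : s = t + (s - t) by ring.
  by rewrite distrC; apply: Hd; rewrite /b in sb; lra.
have b0 : 0 < b by rewrite /b; lra.
(* [g b] is the limit of backward quotients at [b], each within [e] of [f t]. *)
rewrite distrC; apply: (ler_cvg_to (a := (0 : R)^'+)
  (f := fun k => `|k^-1 *: (S b x - S (b - k) x) - f t|) (g := fun=> e)).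
- apply: cvg_norm; apply: cvgB; last exact: cvg_cst.
  exact: orbit_left_derivative.
- exact: cvg_cst.
- near=> k.
  have k0 : 0 < k by near: k; exact: nbhs_right_gt.
  have kh : k <= h by near: k; exact: nbhs_right_le.
  have tbk : t <= b - k by rewrite /b; lra.
  have bkb : b - k <= b by lra.
  have := @right_derivative_mean_value _ _ (fun s => S s x) f (f t) e _ _ bkb.
  rewrite opprB addrCA subrr addr0 => H.
  have -> : k^-1 *: (S b x - S (b - k) x) - f t = k^-1 *: (S b x - S (b - k) x - k *: f t).
    by vec_eq R [:: S b x; S (b - k) x; f t].
  rewrite normrZ gtr0_norm ?invr_gt0 // mulrC ler_pdivrMr //; apply: H => s /andP[s1 s2].
  + by apply: orbit_cvg_left; lra.
  + by apply: orbit_right_derivative; lra.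
  + by apply: fe; lra.
Unshelve. all: end_near. Qed.

End Orbit.

End Semigroup.

(** * Continuity and differentiability from one-sided limits *)

Section OneSidedLimits.
Context {R : realType} {X : normedModType R}.
Implicit Types u : R -> X.

Lemma within_continuous_one_sided u (a : R) :
  (forall s, a <= s -> u (s + h) @[h --> 0^'+] --> u s) ->
  (forall s, a < s -> u (s - h) @[h --> 0^'+] --> u s) ->
  {within `[a, +oo[, continuous u}.
Proof.
move=> uR uL; apply/subspace_continuousP => s; rewrite /= in_itv /= andbT => as_.
apply/cvgrPdist_lt => e e0.
move/cvgrPdist_lt : (uR s as_) => /(_ _ e0)/near_right0P[d1 d10 H1].
have [d2 d20 H2] : exists2 d : R, 0 < d &
    forall h, 0 < h -> h < d -> a <= s - h -> `|u s - u (s - h)| < e.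
  move: as_; rewrite le_eqVlt => /predU1P[->|as_].
    (* At the endpoint no [s - h] lies in the half-line, so any radius will do. *)
    by exists 1 => // h h0 _; lra.
  move/cvgrPdist_lt : (uL s as_) => /(_ _ e0)/near_right0P[d d0 H].
  by exists d => // h h0 hd _; exact: H.
apply/nbhs_ballP; exists (Num.min d1 d2); first by rewrite /= lt_min d10.
move=> r; rewrite /ball /= in_itv /= andbT lt_min => /andP[rd1 rd2] ar.
have [rs|sr|->] := ltgtP r s; last by rewrite subrr normr0.
  have sr : 0 < s - r by rewrite subr_gt0.
  rewrite gtr0_norm // in rd2; have := H2 _ sr rd2; rewrite subKr; exact.
have rs : 0 < r - s by rewrite subr_gt0.
rewrite distrC gtr0_norm // in rd1; have := H1 _ rs rd1.
by rewrite addrCA subrr addr0.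
Qed.

Lemma is_derive_one_sided u (s : R) (d : X) :
  h^-1 *: (u (s + h) - u s) @[h --> 0^'+] --> d ->
  h^-1 *: (u s - u (s - h)) @[h --> 0^'+] --> d ->
  is_derive s 1 u d.
Proof.
move=> uR uL; suff H : h^-1 *: (u (h *: 1 + s) - u s) @[h --> 0^'] --> d.
  by apply: DeriveDef; [apply/cvg_ex; exists d|exact: cvg_lim H].
apply/cvgrPdist_lt => e e0.
move/cvgrPdist_lt : uR => /(_ _ e0)/near_right0P[d1 d10 H1].
move/cvgrPdist_lt : uL => /(_ _ e0)/near_right0P[d2 d20 H2].
apply/nbhs_ballP; exists (Num.min d1 d2); first by rewrite /= lt_min d10.
move=> h; rewrite /ball /= sub0r normrN lt_min => /andP[hd1 hd2] h0.
rewrite [h *: 1]mulr1 [h + s]addrC; have [hlt0|hgt0|h0'] := ltgtP h 0.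
- rewrite ltr0_norm // in hd2.
  have := H2 (- h) ltac:(by rewrite oppr_gt0) hd2.
  by rewrite opprK invrN scaleNr -scalerN opprB.
- by apply: H1; rewrite // -(gtr0_norm hgt0).
- by rewrite h0' eqxx in h0.
Qed.

End OneSidedLimits.

(** * The generator along an orbit, and the theorem *)

Section Generator.
Context {R : realType} {X : completeNormedModType R} {le : X -> X -> Prop}.
Variable S : R -> X -> X.
Hypotheses (HBL : banach_lattice le) (HOC : order_continuous_norm le).
Hypothesis HS : convex_C0_semigroup le S.

Lemma genA_eq (x y : X) : gen S x y -> genA S x = y.
Proof.
by move=> xy; apply: xget_unique => // z xz; apply: (cvg_unique_near xz xy); exact: nearW.
Qed.

(** Changing the sign of the step turns the infimum in direction [- y] into the supremum over
    negative steps. *)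
Lemma dminusE (t : R) (x y : X) : 0 <= t ->
  dminus le S t x y = - ddir le (S t) x (- y).
Proof.
case: HS => _ cS _ _ _ t0.
have [/(is_lubN HBL) lubP _] := ddirP HBL (cS t t0) HOC x (- y).
have E : [set - z | z in [set diff_quot (S t) x (- y) h | h in [set h : R | 0 < h]]] =
    [set h^-1 *: (S t (x + h *: y) - S t x) | h in [set h : R | h < 0]].
  apply/seteqP; split=> [_ [_ [h /= h0 <-] <-]|_ [h /= h0 <-]].
    by exists (- h); rewrite /= ?oppr_lt0 // -diff_quotN.
  exists (diff_quot (S t) x (- y) (- h)); last by rewrite -diff_quotN opprK.
  by exists (- h) => //=; rewrite oppr_gt0.
rewrite E in lubP; apply: xget_unique => // z [z1 z2].
by apply: (bl_antisym HBL); [apply: z2; exact: lubP.1|apply: lubP.2].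
Qed.

(* [ddir] is squeezed between difference quotients of [S s] with a fixed step k, which are
   continuous in s and both close to it at s = t. *)
Lemma ddir_orbit_continuous (x y : X) : gen S x y ->
  {within `[0, +oo[, continuous (fun s => ddir le (S s) x y)}.
Proof.
case: (HS) => _ cS _ _ _ xy.
have cO z : {within `[0, +oo[, continuous (fun s => S s z)}.
  apply: within_continuous_one_sided => s s0; first exact: (orbit_cvg_right HBL HS).
  exact: (orbit_cvg_left HBL HS).
have cq (k t : R) : `[0, +oo[%classic t ->
    diff_quot (S s) x y k @[s --> within `[0, +oo[ (nbhs t)] --> diff_quot (S t) x y k.
  move=> t0.
  have /subspace_continuousP/(_ t t0) H1 := cO (x + k *: y).
  have /subspace_continuousP/(_ t t0) H2 := cO x.
  by apply: cvgZl_tmp; apply: cvgB; [exact: H1|exact: H2].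
apply/subspace_continuousP => t t0; have t0' : 0 <= t by move: t0; rewrite /= in_itv /= andbT.
set f := fun s => ddir le (S s) x y.
(* The final estimate adds six errors of size [e / 8]: two direct ones and four bounding
   [q s k - q s (- k)]. *)
apply/cvgrPdist_le => e e0; have e8 : 0 < e / 8 by rewrite divr_gt0.
have Hp := ddir_cvg HBL (cS t t0') HOC (x := x) (y := y).
(* Here the equality of the two one-sided derivatives is essential. *)
have Hm : diff_quot (S t) x y (- k) @[k --> 0^'+] --> f t.
  rewrite /f (ddir_orbitE HBL HOC HS xy t0').
  under eq_fun do rewrite diff_quotN.
  by apply: cvgN; exact: (ddir_cvg HBL (cS t t0') HOC).
move/cvgrPdist_le : Hp => /(_ _ e8) Hp; move/cvgrPdist_le : Hm => /(_ _ e8) Hm.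
have [k [k0 [kp km]]] := filter_ex (filterI (nbhs_right_gt 0) (filterI Hp Hm)).
have /cvgrPdist_le/(_ _ e8) := cq k t t0.
have /cvgrPdist_le/(_ _ e8) := cq (- k) t t0.
apply: filter_app2; near=> s.
have s0 : 0 <= s.
  suff : `[0, +oo[%classic s by rewrite /= in_itv /= andbT.
  by near: s; exact: withinT.
set q := fun s k => diff_quot (S s) x y k; rewrite -!/(q _ _) => sm sp.
have l1 : le (q s (- k)) (f s).
  by rewrite /f (ddir_orbitE HBL HOC HS xy s0); exact: (ddirN_ge HBL (cS s s0) HOC).
have l2 : le (f s) (q s k) by exact: (ddir_le HBL (cS s s0) HOC).
have n1 : `|f s - q s (- k)| <= `|q s k - q s (- k)|.
  apply: (le0_norm HBL); first by apply: (le_shift HBL l1); rewrite subr0.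
  by apply: (le_shift HBL l2); vec_eq R [:: f s; q s k; q s (- k)].
have -> : f t - f s = (f t - q t (- k)) + (q t (- k) - q s (- k)) - (f s - q s (- k)).
  by vec_eq R [:: f t; f s; q t (- k); q s (- k)].
have E : q s k - q s (- k) = ((f t - q t (- k)) + (q t (- k) - q s (- k))) -
    ((f t - q t k) + (q t k - q s k)).
  by vec_eq R [:: f t; q t k; q s k; q t (- k); q s (- k)].
have := ler_normB ((f t - q t (- k)) + (q t (- k) - q s (- k))) ((f t - q t k) + (q t k - q s k)).
rewrite -E.
have := ler_normB ((f t - q t (- k)) + (q t (- k) - q s (- k))) (f s - q s (- k)).
have := ler_normD (f t - q t (- k)) (q t (- k) - q s (- k)).
have := ler_normD (f t - q t k) (q t k - q s k).
rewrite -!/(q _ _) in kp km; rewrite -/(f t) in kp.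
lra.
Unshelve. all: end_near. Qed.

End Generator.

(** All tags are at least [a], so agreement from [a] on suffices; the integrands of the theorem are
    only compared at nonnegative times. *)
Lemma eq_is_riemann_integral (R : realType) (X : normedModType R) (f g : R -> X) (a b : R) (J : X) :
  (forall s, a <= s -> f s = g s) ->
  is_riemann_integral f a b J -> is_riemann_integral g a b J.
Proof.
move=> fg fJ e /fJ[d d0 H]; exists d => // n p q pa pb Hpq.
have pge i : (i <= n)%N -> a <= p i.
  elim: i => [_|i IH lin]; first by rewrite pa.
  have [/andP[pq qp] _] := Hpq i lin.
  exact: le_trans (IH (ltnW lin)) (le_trans pq qp).
have := H n p q pa pb Hpq; congr (`| _ - _ | < _); apply: eq_bigr => i _; congr (_ *: _).
have [/andP[pq _] _] := Hpq i (ltn_ord i).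
by apply: fg; exact: le_trans (pge i (ltnW (ltn_ord i))) pq.
Qed.

Theorem theorem3p3 (R : realType) (X : completeNormedModType R)
  (le : X -> X -> Prop) (S : R -> X -> X)
  (HBL : banach_lattice le) (HOC : order_continuous_norm le)
  (HS : convex_C0_semigroup le S)
  (x : X) (t : R) (hx : inD S x) (ht : 0 <= t) :
  (* (i) *)
  (inD S (S t x) /\ genA S (S t x) = dplus le S t x (genA S x) /\
   (linear_op (S t) -> genA S (S t x) = S t (genA S x))) /\
  (* (ii) *)
  (0 < t -> h^-1 *: (S t x - S (t - h) x) @[h --> 0^'+] -->
              dminus le S t x (genA S x)) /\
  (* (iii) *)
  (dplus le S t x (genA S x) = dminus le S t x (genA S x) /\
   h^-1 *: (S h x - x) @[h --> 0^'+] --> dplus le S 0 x (genA S x) /\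
   (forall s : R, 0 < s -> is_derive s 1 (fun r => S r x) (genA S (S s x))) /\
   (forall s : R, 0 <= s ->
      genA S (S s x) = dplus le S s x (genA S x) /\
      genA S (S s x) = dminus le S s x (genA S x)) /\
   {within `[0, +oo[, continuous (fun s => genA S (S s x))}) /\
  (* (iv) *)
  (is_riemann_integral (fun s => genA S (S s x)) 0 t (S t x - x) /\
   is_riemann_integral (fun s => dplus le S s x (genA S x)) 0 t (S t x - x) /\
   is_riemann_integral (fun s => dminus le S s x (genA S x)) 0 t (S t x - x)).
Proof.
case: hx => y xy; rewrite (genA_eq xy).
have AE s : 0 <= s -> genA S (S s x) = ddir le (S s) x y.
  by move=> s0; apply: genA_eq; exact: (gen_orbit HBL HOC HS xy).
have dE s : 0 <= s -> ddir le (S s) x y = dminus le S s x y.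
  by move=> s0; rewrite (dminusE HBL HOC HS) // -(ddir_orbitE HBL HOC HS xy s0).
have S0x : S 0 x = x by case: HS.
have cA : {within `[0, +oo[, continuous (fun s => genA S (S s x))}.
  apply/subspace_continuousP => s s0.
  have s0' : 0 <= s by move: s0; rewrite /= in_itv /= andbT.
  have H : ddir le (S r) x y @[r --> within `[0, +oo[ (nbhs s)] --> ddir le (S s) x y.
    by move: s s0 {s0'}; apply/subspace_continuousP; exact: (ddir_orbit_continuous HBL HOC HS xy).
  suff : genA S (S r x) @[r --> within `[0, +oo[ (nbhs s)] --> ddir le (S s) x y.
    by rewrite -AE.
  apply: cvg_trans H; apply: near_eq_cvg; near=> r; rewrite AE //.
  suff : `[0, +oo[%classic r by rewrite /= in_itv /= andbT.
  by near: r; exact: withinT.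
have IA : is_riemann_integral (fun s => genA S (S s x)) 0 t (S t x - x).
  rewrite -[in X in _ - X]S0x.
  apply: (riemann_integral_right_derivative (u := fun s => S s x)) => // [s|s|].
  - by move=> /andP[s0 _]; exact: (orbit_cvg_left HBL HS).
  - by move=> /andP[s0 _]; rewrite AE //; exact: (orbit_right_derivative HBL HOC HS xy).
  - apply: continuous_subspaceW cA => s; rewrite /= !in_itv /= andbT.
    by case/andP.
split; [|split; [|split]].
- split; first by exists (ddir le (S t) x y); exact: (gen_orbit HBL HOC HS xy).
  split=> [|lin]; first exact: AE.
  have ct : convex_op le (S t) by case: HS => _ cS _ _ _; exact: cS.
  (* For linear [S t] every difference quotient equals [S t y], hence so does its limit. *)
  have H := ddir_cvg HBL ct HOC (x := x) (y := y).
  have C : (fun=> S t y) @ (0 : R)^'+ --> S t y by exact: cvg_cst.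
  rewrite AE //; apply: (cvg_unique_near H C).
  near=> h; have h0 : h != 0 by rewrite gt_eqF //; near: h; exact: nbhs_right_gt.
  rewrite /diff_quot; have := lin 1 h x y; rewrite !scale1r => ->.
  by rewrite addrAC subrr add0r scalerA mulVf // scale1r.
- by move=> t0; rewrite (dminusE HBL HOC HS) //; exact: (orbit_left_derivative HBL HOC HS xy).
- split; first exact: dE.
  (* The right derivative at 0 is [gen_orbit] at time 0. *)
  split; first by have := gen_orbit HBL HOC HS xy (lexx 0); rewrite S0x.
  split; [move=> s s0|split => // s s0].
    apply: is_derive_one_sided; rewrite AE ?(ltW s0) //.
      by apply: (orbit_right_derivative HBL HOC HS xy); exact: ltW.
    rewrite (ddir_orbitE HBL HOC HS xy (ltW s0)).
    exact: (orbit_left_derivative HBL HOC HS xy).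
  by rewrite -dE // AE.
- split; first exact: IA.
  split; apply: eq_is_riemann_integral IA => s s0; rewrite AE //; exact: dE.
Unshelve. all: end_near. Qed.
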